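(* The problem ACS-Enum is MIS-Enum-hard even when restricted to acyclic implicational bases of conclusion-degree at most $2$: there is a polynomial-time transformation of Sperner hypergraphs $\mathcal{H}$ into instances $((X,\Sigma),z)$ of ACS-Enum with $\Sigma$ acyclic and of conclusion-degree at most $2$ such that $\mathrm{irr}(z)=\mathrm{MIS}(\mathcal{H})$.
   Context: A hypergraph $\mathcal{H}=(V,\mathcal{E})$ is Sperner if its edges are pairwise incomparable; $\mathrm{MIS}(\mathcal{H})$ is the family of inclusion-maximal subsets of $V$ containing no edge; MIS-Enum asks to list $\mathrm{MIS}(\mathcal{H})$. An implicational base $(X,\Sigma)$ is a set of implications $A\to B$ with $A,B\subseteq X$ disjoint; its closed sets are the $C\subseteq X$ with $A\subseteq C\Rightarrow B\subseteq C$ for all $A\to B\in\Sigma$. For $x\in X$, $\mathrm{irr}(x)$ is the family of inclusion-maximal closed sets not containing $x$. ACS-Enum: given $(X,\Sigma)$ and $x\in X$, list $\mathrm{irr}(x)$. The implication graph has an arc $ab$ whenever $a\in A$, $b\in B$ for some $A\to B\in\Sigma$; $\Sigma$ is acyclic if this graph is. The conclusion-degree of $\Sigma$ is the maximum over $x\in X$ of the number of implications whose conclusion contains $x$. *)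

(* Defs.v *)
From HB Require Import structures.
From mathcomp Require Export all_boot all_order all_algebra finmap.

Set Implicit Arguments.
Unset Strict Implicit.
Unset Printing Implicit Defensive.

Local Open Scope fset_scope.

(* Vertices and ground elements are named by binary words, so that families of
   subsets of two different ground sets can be compared by equality. *)
Definition name := seq bool.

Definition maximal (P : {fset name} -> Prop) (C : {fset name}) : Prop :=
  P C /\ forall D : {fset name}, P D -> C `<=` D -> D = C.

Record hypergraph := Hypergraph {
  vertices : {fset name};
  edges : {fset {fset name}};
  edges_sub : forall e, e \in edges -> e `<=` vertices }.

Definition sperner (H : hypergraph) : Prop :=
  forall e f, e \in edges H -> f \in edges H -> e `<=` f -> e = f.

Definition independent (H : hypergraph) (S : {fset name}) : Prop :=
  S `<=` vertices H /\ forall e, e \in edges H -> ~ (e `<=` S).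

Definition MIS (H : hypergraph) : {fset name} -> Prop :=
  maximal (independent H).

(* The pair (A, B) stands for the implication A -> B. *)
Record implicational_base := ImplicationalBase {
  ground : {fset name};
  implications : {fset {fset name} * {fset name}};
  implications_sub : forall i, i \in implications ->
    [/\ i.1 `<=` ground, i.2 `<=` ground & [disjoint i.1 & i.2]] }.

Definition closed_set (B : implicational_base) (C : {fset name}) : Prop :=
  C `<=` ground B /\
  forall i, i \in implications B -> i.1 `<=` C -> i.2 `<=` C.

Definition irr (B : implicational_base) (x : name) : {fset name} -> Prop :=
  maximal (fun C => closed_set B C /\ x \notin C).

Definition implication_graph (B : implicational_base) : rel name :=
  fun a b => has (fun i => (a \in i.1) && (b \in i.2)) (implications B).

Definition acyclic (B : implicational_base) : Prop :=
  forall c : seq name, cycle (implication_graph B) c -> c = [::].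

Definition conclusion_degree (B : implicational_base) : nat :=
  \max_(x <- ground B) #|` [fset i in implications B | x \in i.2]|.

Record acs_instance := AcsInstance {
  base : implicational_base;
  target : name;
  target_in : target \in ground base }.

Variant move := MoveLeft | Stay | MoveRight.

(* A cell holds a letter of A or is blank (None). *)
Notation cell A := (option A).

(* A two-way infinite tape, blank outside the cells listed: tape_left is read
   leftwards from the head, tape_right rightwards. *)
Record tape (A : Type) := Tape {
  tape_left : seq (cell A);
  tape_head : cell A;
  tape_right : seq (cell A) }.

Definition tape_of_word (A : Type) (w : seq A) : tape A :=
  Tape [::] (ohead w) (map some (behead w)).

Definition tape_holds (A : Type) (T : tape A) (w : seq A) : Prop :=
  exists i j : nat,
    rev (tape_left T) ++ tape_head T :: tape_right T =
    nseq i None ++ map some w ++ nseq j None.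

Definition tape_act (A : Type) (a : cell A * move) (T : tape A) : tape A :=
  let: Tape l _ r := T in
  match a.2 with
  | MoveLeft => Tape (behead l) (head None l) (a.1 :: r)
  | Stay => Tape l a.1 r
  | MoveRight => Tape (a.1 :: l) (head None r) (behead r)
  end.

(* The machine has extra_tapes.+1 tapes: the input is on the first one, the
   output is read off the last one. *)
Record machine (A : finType) := Machine {
  extra_tapes : nat;
  state : finType;
  start : state;
  halted : pred state;
  transition : state -> extra_tapes.+1.-tuple (cell A) ->
    state * extra_tapes.+1.-tuple (cell A * move) }.

Definition config (A : finType) (M : machine A) : Type :=
  (state M * (extra_tapes M).+1.-tuple (tape A))%type.

Definition init_config (A : finType) (M : machine A) (w : seq A) : config M :=
  (start M, [tuple of tape_of_word w ::
                      nseq (extra_tapes M) (tape_of_word [::])]).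

Definition step (A : finType) (M : machine A) (c : config M) : config M :=
  if halted c.1 then c else
  let: (q, acts) := transition c.1 (map_tuple (@tape_head A) c.2) in
  (q, [tuple tape_act (tnth acts i) (tnth c.2 i) | i < (extra_tapes M).+1]).

(* Halted configurations are fixed by step, so this says that M halts on input
   w after at most t steps, with output w'. *)
Definition outputs_within (A : finType) (M : machine A) (t : nat)
    (w w' : seq A) : Prop :=
  let c := iter t (@step A M) (init_config M w) in
  halted c.1 /\ tape_holds (tnth c.2 ord_max) w'.

Variant symbol := Bit of bool | Comma | Semicolon | Arrow.

Definition symbol_to_sum (s : symbol) : bool + 'I_3 :=
  match s with
  | Bit b => inl b
  | Comma => inr (inord 0)
  | Semicolon => inr (inord 1)
  | Arrow => inr (inord 2)
  end.

Definition symbol_of_sum (s : bool + 'I_3) : symbol :=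
  match s with
  | inl b => Bit b
  | inr i => nth Comma [:: Comma; Semicolon; Arrow] i
  end.

Lemma symbol_to_sumK : cancel symbol_to_sum symbol_of_sum.
Proof. by case=> //=; rewrite inordK. Qed.

HB.instance Definition _ := Finite.copy symbol (can_type symbol_to_sumK).

Definition write_name (x : name) : seq symbol := map Bit x.

Definition write_names (s : seq name) : seq symbol :=
  flatten [seq rcons (write_name x) Comma | x <- s].

(* A finite set is written as the list of its elements, in any order and
   without repetition. *)
Definition encodes_set (A : {fset name}) (w : seq symbol) : Prop :=
  exists2 s : seq name, perm_eq s A & w = write_names s.

(* V ; E_1 ; ... ; E_m ; *)
Definition encodes_hypergraph (H : hypergraph) (w : seq symbol) : Prop :=
  exists (v : seq symbol) (es : seq ({fset name} * seq symbol)),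
    [/\ encodes_set (vertices H) v,
        perm_eq (map fst es) (edges H),
        forall e, e \in es -> encodes_set e.1 e.2
      & w = v ++ Semicolon :: flatten [seq rcons e.2 Semicolon | e <- es]].

(* X ; z ; A_1 -> B_1 ; ... ; A_m -> B_m ; *)
Definition encodes_acs (I : acs_instance) (w : seq symbol) : Prop :=
  exists (v : seq symbol)
      (imps : seq (({fset name} * {fset name}) * (seq symbol * seq symbol))),
    [/\ encodes_set (ground (base I)) v,
        perm_eq (map fst imps) (implications (base I)),
        forall i, i \in imps ->
          encodes_set i.1.1 i.2.1 /\ encodes_set i.1.2 i.2.2
      & w = v ++ Semicolon :: write_name (target I) ++ Semicolon ::
            flatten [seq rcons (i.2.1 ++ Arrow :: i.2.2) Semicolon | i <- imps]].

(* Main.v *)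
From HB Require Import structures.
From mathcomp Require Import zify.
Require Import Defs.

(* Let E_1, ..., E_m be the edges of H, in the order of the input. Add fresh
   elements y_0, ..., y_m with implications E_i -> y_i and y_i -> y_(i-1), and
   take y_0 as the target. A closed set avoiding y_0 avoids every y_i, hence
   contains no edge; conversely an independent set of H is closed. Only E_i and
   y_(i+1) imply y_i, and every arc enters some y_j from a vertex or from some y_i
   with j < i, so the base is acyclic of conclusion-degree at most 2.

   The name of y_i is the word 1^k, where k is the position in the input of the
   semicolon that ends E_i (of the one that ends the vertex set, for i = 0): it is
   longer than every vertex name, and a two-tape machine produces it by sweeping
   over the input. *)

Set Implicit Arguments.
Unset Strict Implicit.
Unset Printing Implicit Defensive.

Local Open Scope fset_scope.

(** * Unary names and the words that encode sets *)

Definition unary (k : nat) : name := nseq k true.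

Lemma unary_inj : injective unary.
Proof. by move=> j k /(congr1 size); rewrite !size_nseq. Qed.

Lemma write_names_cat s t : write_names (s ++ t) = write_names s ++ write_names t.
Proof. by rewrite /write_names map_cat flatten_cat. Qed.

Lemma write_unary k : write_name (unary k) = nseq k (Bit true).
Proof. exact: map_nseq. Qed.

Lemma write_names1 x : write_names [:: x] = rcons (write_name x) Comma.
Proof. exact: cats0. Qed.

(** The comma after each name makes the inequality strict; hence a unary name at least as long as
    the encoding of the vertex set is not a vertex. *)
Lemma size_write_names (s : seq name) (x : name) :
  x \in s -> size x < size (write_names s).
Proof.
elim: s => // y s IHs; rewrite inE /write_names /= size_cat size_rcons size_map.
by case/predU1P => [->|/IHs/leq_trans->]; rewrite ?leq_addr ?leq_addl.
Qed.

(** Semicolons thus mark only the ends of blocks, which is how the machine recognises them. *)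
Lemma semicolon_write_names s : Semicolon \notin write_names s.
Proof.
elim: s => // x s IHs; rewrite /write_names /= mem_cat negb_or IHs andbT.
rewrite mem_rcons inE negb_or; apply/andP.
by split; [apply/eqP | apply/mapP => -[]].
Qed.

(** * The chain of implications *)

Section Reduction.

Implicit Types (k : nat) (e : {fset name} * seq symbol)
  (es : seq ({fset name} * seq symbol)).

(** Here [k] is the position of the semicolon before the first word of [es]; the [.+1] accounts for
    the semicolon that ends each word. *)
Fixpoint positions k es : seq nat :=
  if es is e :: es' then
    let k' := (k + (size e.2).+1)%N in k' :: positions k' es'
  else [::].

(** Each implication is paired with the encodings of its two sides, in the order in which the
    machine writes them, so that this very list can witness [encodes_acs]. *)
Fixpoint chain k es :
    seq (({fset name} * {fset name}) * (seq symbol * seq symbol)) :=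
  if es is e :: es' then
    let k' := (k + (size e.2).+1)%N in
    [:: ((e.1, [fset unary k']), (e.2, write_names [:: unary k'])),
        (([fset unary k'], [fset unary k]),
         (write_names [:: unary k'], write_names [:: unary k]))
      & chain k' es']
  else [::].

Lemma positions_gt k es j : j \in positions k es -> k < j.
Proof.
elim: es k => //= e es IHes k; rewrite inE => /predU1P[->|/IHes]; lia.
Qed.

Lemma uniq_positions k es : uniq (k :: positions k es).
Proof.
elim: es k => // e es IHes k; rewrite cons_uniq; apply/andP; split.
  by apply/negP => /positions_gt; rewrite ltnn.
exact: IHes.
Qed.

(** The matching of edges with positions is dropped: membership and the order of the two ends of a
    link are enough for disjointness and acyclicity. *)
Variant chain_spec k es : {fset name} * {fset name} -> Prop :=
| EdgeImplication e j of e \in es & j \in positions k es :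
    chain_spec k es (e.1, [fset unary j])
| LinkImplication j j' of j' \in positions k es & j \in k :: positions k es
    & j < j' : chain_spec k es ([fset unary j'], [fset unary j]).

Lemma chainP k es i : i \in map fst (chain k es) -> chain_spec k es i.
Proof.
elim: es k => //= e es IHes k; rewrite !inE.
case/or3P => [/eqP->|/eqP->|/IHes[f j fin jin|j j' jin' jin lt_j]].
- by left; rewrite ?inE ?eqxx.
- by right; rewrite /= ?inE ?eqxx //; lia.
- by left; rewrite /= ?inE ?fin ?jin orbT.
- by right; rewrite //= inE ?jin ?jin' orbT.
Qed.

Lemma chain_conclusion_ge k es i j :
  i \in map fst (chain k es) -> unary j \in i.2 -> k <= j.
Proof.
case/chainP => [e j' _ /positions_gt|j' j'' _ /=] lt_k.
  by rewrite inE => /eqP/unary_inj->; lia.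
move=> _; rewrite inE => /eqP/unary_inj->.
by move: lt_k; rewrite inE => /predU1P[->|/positions_gt]; lia.
Qed.

Lemma count_chain_lt k es j : j < k ->
  count (fun i : {fset name} * {fset name} => unary j \in i.2)
    (map fst (chain k es)) = 0.
Proof.
move=> lt_jk; apply/eqP; rewrite -leqn0 leqNgt -has_count; apply/hasPn => i.
by move=> /chain_conclusion_ge ge_k; apply/negP => /ge_k; lia.
Qed.

(** The sharper bound 1 at [unary k] carries the induction: the next name is concluded once by the
    first edge and at most once by the rest of the chain, while [unary k] is concluded only by the
    first link. *)
Lemma count_chain k es x :
  count (fun i : {fset name} * {fset name} => x \in i.2)
    (map fst (chain k es)) <= (x != unary k).+1.
Proof.
elim: es k => //= e es IHes k; rewrite !inE.
have ne_k : unary k != unary (k + (size e.2).+1)%N.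
  by apply/eqP => /unary_inj; lia.
have [->|ne_xk] := eqVneq x (unary k).
  by rewrite (negPf ne_k) count_chain_lt //; lia.
by move: (IHes (k + (size e.2).+1)%N); case: eqP => _ /=; lia.
Qed.

End Reduction.

(** * The implicational base of an encoded hypergraph *)

Section Instance.

Variables (H : hypergraph) (v : seq symbol).
Variable es : seq ({fset name} * seq symbol).
Hypothesis enc_v : encodes_set (vertices H) v.
Hypothesis enc_E : perm_eq (map fst es) (edges H).

Let V := vertices H.
Let k0 := size v.
Let ys := [seq unary k | k <- k0 :: positions k0 es].

Lemma unary_notin_vertices k : k0 <= k -> unary k \notin V.
Proof.
move=> le_k; apply/negP => yV; case: enc_v => s eq_s def_v.
have /size_write_names : unary k \in s by rewrite (perm_mem eq_s).
by rewrite -def_v size_nseq ltnNge le_k.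
Qed.

Lemma position_notin_vertices k :
  k \in k0 :: positions k0 es -> unary k \notin V.
Proof.
rewrite inE => k_in; apply: unary_notin_vertices.
by case/predU1P: k_in => [->|/positions_gt] //; lia.
Qed.

Lemma edge_sub e : e \in es -> e.1 `<=` V.
Proof.
by move=> e_in; apply: edges_sub; rewrite -(perm_mem enc_E) map_f.
Qed.

Lemma chain_sub i : i \in [fset j in map fst (chain k0 es)] ->
  let X := V `|` [fset y in ys] in
  [/\ i.1 `<=` X, i.2 `<=` X & [disjoint i.1 & i.2]].
Proof.
have yX k : k \in k0 :: positions k0 es ->
    [fset unary k] `<=` V `|` [fset y in ys].
  move=> /(map_f unary) y_in; rewrite fsub1set in_fsetU.
  by apply/orP; right; rewrite in_fset.
rewrite inE /= => /chainP[e j e_in j_in|j j' j'_in j_in lt_j] /=.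
  have j_in' : j \in k0 :: positions k0 es by rewrite inE j_in orbT.
  split; [|exact: yX|].
    exact: fsubset_trans (edge_sub e_in) (fsubsetUl _ _).
  rewrite fdisjoint_sym; apply/fdisjointP => x; rewrite inE => /eqP->.
  apply: contra (position_notin_vertices j_in').
  exact: (fsubsetP (edge_sub e_in)).
split; [|exact: yX|]; first by apply: yX; rewrite inE j'_in orbT.
apply/fdisjointP => x; rewrite !inE => /eqP->.
by apply/eqP => /unary_inj; lia.
Qed.

Definition chain_base := ImplicationalBase chain_sub.

Lemma chain_target_in : unary k0 \in ground chain_base.
Proof. by rewrite !inE eqxx orbT. Qed.

Definition chain_instance := AcsInstance chain_target_in.

Lemma uniq_ground s : perm_eq s V -> uniq (s ++ ys).
Proof.
move=> eq_s; rewrite cat_uniq (perm_uniq eq_s) fset_uniq.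
rewrite (map_inj_uniq unary_inj) uniq_positions andbT andTb.
apply/hasPn => y /mapP[k /position_notin_vertices yV ->].
by rewrite (perm_mem eq_s).
Qed.

(** By this the list enumerates the set of implications without repetition, as [encodes_acs]
    asks. *)
Lemma uniq_chain : uniq (map fst (chain k0 es)).
Proof.
(* Generalised to a suffix [fs], for which [enc_E] survives only as inclusion of the edges in [V]
   and their distinctness. *)
suff uniq_from fs k : k0 <= k -> (forall e, e \in fs -> e.1 `<=` V) ->
    uniq (map fst fs) -> uniq (map fst (chain k fs)).
  apply: uniq_from (leqnn k0) _ _; first exact: edge_sub.
  by rewrite (perm_uniq enc_E) fset_uniq.
elim: fs k => //= e fs IHfs k le_k sub_V /andP[e_notin fs_uniq].
have chain_uniq : uniq (map fst (chain (k + (size e.2).+1)%N fs)).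
  apply: IHfs => // [|f f_in]; first by lia.
  by apply: sub_V; rewrite inE f_in orbT.
rewrite inE negb_or chain_uniq.
rewrite andbT -andbA; apply/and3P; split.
- apply/eqP => -[_ /fset1_inj/unary_inj]; lia.
- apply/negP; move def_i: (e.1, _) => i /chainP in_chain.
  case: in_chain def_i => [f j f_in _|j j' j'_in _ lt_j] [eq_e _].
    by case/negP: e_notin; rewrite eq_e map_f.
  (* An edge equal to the premise of a later link would put a name of length at least [k0] into
     [V]. *)
  have: unary j' \in V.
    by apply: (fsubsetP (sub_V e (mem_head _ _))); rewrite eq_e inE.
  by apply/negP/unary_notin_vertices; move/positions_gt: j'_in; lia.
- apply/negP => /chain_conclusion_ge /(_ (fset11 _)); lia.
Qed.

Lemma acyclic_chain : acyclic chain_base.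
Proof.
(* A strict order containing every arc: vertices come first, then the other names by decreasing
   length. Around a cycle, transitivity would give [R x x]. *)
pose R : rel name := fun a b => (b \notin V) && ((a \in V) || (size b < size a)).
have R_trans : transitive R.
  by move=> b a c; rewrite /R; case: (b \in V) => //=; lia.
have subR : subrel (implication_graph chain_base) R.
  move=> a b /(@hasP ({fset name} * {fset name})%type _ _)[i] /=.
  rewrite in_fset => /chainP in_chain /andP[].
  case: in_chain => [e j e_in j_in|j j' j'_in j_in lt_j] /=.
    move=> /(fsubsetP (edge_sub e_in)) aV; rewrite inE => /eqP->.
    by rewrite /R aV position_notin_vertices // inE j_in orbT.
  rewrite !inE => /eqP-> /eqP->.
  by rewrite /R position_notin_vertices // !size_nseq lt_j orbT.
case=> // x p /= /(sub_path subR) /(order_path_min R_trans).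
by rewrite all_rcons /R ltnn orbF; case: (x \in V).
Qed.

Lemma conclusion_degree_chain : conclusion_degree chain_base <= 2.
Proof.
apply/bigmax_leqP_seq => x _ _.
apply: leq_trans (leq_trans (count_chain k0 es x) _); last by case: eqP.
rewrite -size_filter; apply: uniq_leq_size; first exact: fset_uniq.
by move=> i; rewrite mem_filter !inE andbC.
Qed.

(** Avoidance of the target climbs the chain: each link passes it on to the next name, whose absence
    then rules out the corresponding edge. Conversely, every premise fails in an independent set, so
    closedness is vacuous. *)
Lemma closed_chainP C :
  (closed_set chain_base C /\ unary k0 \notin C) <-> independent H C.
Proof.
split=> [[[subX closed_C] zC]|[subV indep_C]].
  have closed_chain : forall i, i \in map fst (chain k0 es) ->
      i.1 `<=` C -> i.2 `<=` C.
    by move=> i i_in; apply: closed_C; rewrite inE.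
  have [noE noY] : (forall e, e \in es -> ~~ (e.1 `<=` C)) /\
      (forall k, k \in k0 :: positions k0 es -> unary k \notin C).
    (* The start of the chain varies in the induction, under the assumption that its name lies
       outside [C]. *)
    elim: es k0 zC closed_chain {subX closed_C} => /= [|e fs IHfs] k yC cl.
      by split=> // j; rewrite inE => /eqP->.
    have y'C : unary (k + (size e.2).+1)%N \notin C.
      apply: contra yC; rewrite -!fsub1set => yC.
      by apply: (cl ([fset _], [fset _]) _ yC); rewrite !inE eqxx orbT.
    have [|noE noY] := IHfs _ y'C.
      by move=> i i_in; apply: cl; rewrite !inE i_in !orbT.
    split=> [f|j]; rewrite inE => /predU1P[->|] //; [|exact: noE|exact: noY].
    apply: contra y'C; rewrite -fsub1set => eC.
    by apply: (cl (e.1, [fset _]) _ eC); rewrite inE eqxx.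
  split.
    apply/fsubsetP => x xC; move/fsubsetP/(_ x xC): subX.
    rewrite in_fsetU in_fset => /orP[//|/mapP[k /noY yC def_x]].
    by rewrite def_x (negPf yC) in xC.
  move=> e; rewrite -(perm_mem enc_E) => /mapP[f f_in ->].
  exact/negP/noE.
have noY k : k \in k0 :: positions k0 es -> unary k \notin C.
  by move=> /position_notin_vertices; apply: contra => /(fsubsetP subV).
split; last by apply: noY; rewrite mem_head.
split; first exact: fsubset_trans subV (fsubsetUl _ _).
move=> i; rewrite inE /= => /chainP[e j e_in _|j j' j'_in _ _] /=.
  by case/indep_C; rewrite -(perm_mem enc_E) map_f.
by rewrite fsub1set => yC; have:= noY j'; rewrite inE j'_in orbT yC => /(_ isT).
Qed.

(** The two families of candidate sets coincide, hence so do their maximal members. *)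
Lemma irr_chain C : irr chain_base (unary k0) C <-> MIS H C.
Proof.
split=> -[PC maxC]; split=> [|D PD]; try exact/closed_chainP;
  exact/maxC/closed_chainP.
Qed.

Definition chain_output : seq symbol :=
  v ++ write_names ys ++ Semicolon :: write_name (unary k0) ++ Semicolon ::
  flatten [seq rcons (i.2.1 ++ Arrow :: i.2.2) Semicolon | i <- chain k0 es].

Lemma encodes_chain :
  (forall e, e \in es -> encodes_set e.1 e.2) ->
  encodes_acs chain_instance chain_output.
Proof.
move=> enc_e; exists (v ++ write_names ys), (chain k0 es); split.
- case: enc_v => s eq_s ->; exists (s ++ ys); last by rewrite write_names_cat.
  apply: uniq_perm; rewrite ?uniq_ground ?fset_uniq // => x.
  by rewrite mem_cat (perm_mem eq_s) !inE.
- apply: uniq_perm; rewrite ?uniq_chain ?fset_uniq // => i.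
  by rewrite inE.
- have enc1 k : encodes_set [fset unary k] (write_names [:: unary k]).
    exists [:: unary k] => //; apply: uniq_perm; rewrite ?fset_uniq // => x.
    by rewrite !inE.
  elim: es k0 enc_e => //= e fs IHfs k enc_e i; rewrite !inE.
  case/or3P => [/eqP->|/eqP->|/IHfs] /=.
  + by split; [apply: enc_e; rewrite mem_head | apply: enc1].
  + by split; apply: enc1.
  + by apply=> f f_in; apply: enc_e; rewrite inE f_in orbT.
- by rewrite /chain_output !catA.
Qed.

End Instance.

(** * The machine *)

Section Transducer.

Local Open Scope nat_scope.

Variant unary_use := ForGround | ForTarget | ForConclusion | ForPremise | ForLink.

(** [CopyVertices] and [ScanEdges] write the ground set. After [Rewind], [SkipVertices] leads to the
    semicolon whose position names the target, and the loop through [CopyEdge] writes two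
    implications per edge. [Count] and [Return] form a shared subroutine whose parameter tells where
    to resume. *)
Variant control :=
  Init | Entry | CopyVertices | ScanEdges | Rewind | SkipVertices | CopyEdge
| SkipBack | Halt | Count of unary_use | Return of unary_use.

Definition use_to_ord (u : unary_use) : 'I_5 :=
  match u with
  | ForGround => inord 0
  | ForTarget => inord 1
  | ForConclusion => inord 2
  | ForPremise => inord 3
  | ForLink => inord 4
  end.

Definition use_of_ord (i : 'I_5) : unary_use :=
  nth ForGround [:: ForGround; ForTarget; ForConclusion; ForPremise; ForLink] i.

Lemma use_to_ordK : cancel use_to_ord use_of_ord.
Proof. by case; rewrite /use_of_ord /= inordK. Qed.

HB.instance Definition _ := Finite.copy unary_use (can_type use_to_ordK).

Definition control_to_sum (q : control) : 'I_9 + bool * unary_use :=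
  match q with
  | Init => inl (inord 0)
  | Entry => inl (inord 1)
  | CopyVertices => inl (inord 2)
  | ScanEdges => inl (inord 3)
  | Rewind => inl (inord 4)
  | SkipVertices => inl (inord 5)
  | CopyEdge => inl (inord 6)
  | SkipBack => inl (inord 7)
  | Halt => inl (inord 8)
  | Count u => inr (true, u)
  | Return u => inr (false, u)
  end.

Definition control_of_sum (s : 'I_9 + bool * unary_use) : control :=
  match s with
  | inl i => nth Init [:: Init; Entry; CopyVertices; ScanEdges; Rewind;
                          SkipVertices; CopyEdge; SkipBack; Halt] i
  | inr (true, u) => Count u
  | inr (false, u) => Return u
  end.

Lemma control_to_sumK : cancel control_to_sum control_of_sum.
Proof. by case=> //=; rewrite inordK. Qed.

HB.instance Definition _ := Finite.copy control (can_type control_to_sumK).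

Definition is_halt (q : control) : bool := if q is Halt then true else false.

(** In [encodes_acs] the target is a bare name before a semicolon; every other unary name is an
    element of an encoded set. *)
Definition terminator (u : unary_use) : symbol :=
  if u is ForTarget then Semicolon else Comma.

(* The action on the input tape, and the letter (if any) appended to the output.
   To write the position of a semicolon in unary, the machine blanks that cell,
   sweeps left to the blank before the word emitting one bit per cell, and
   sweeps right to the blanked cell, which it eventually restores. *)
Definition delta (q : control) (a : cell symbol) :
    control * (cell symbol * move) * cell symbol :=
  match q, a with
  | Init, _ => (Entry, (a, MoveLeft), None)
  | Entry, _ => (CopyVertices, (a, MoveRight), None)
  | CopyVertices, Some Semicolon => (Count ForGround, (None, MoveLeft), None)
  | CopyVertices, Some _ => (CopyVertices, (a, MoveRight), a)
  | ScanEdges, Some Semicolon => (Count ForGround, (None, MoveLeft), None)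
  | ScanEdges, Some _ => (ScanEdges, (a, MoveRight), None)
  | ScanEdges, None => (Rewind, (a, MoveLeft), Some Semicolon)
  | Rewind, Some _ => (Rewind, (a, MoveLeft), None)
  | Rewind, None => (SkipVertices, (a, MoveRight), None)
  | SkipVertices, Some Semicolon => (Count ForTarget, (None, MoveLeft), None)
  | SkipVertices, Some _ => (SkipVertices, (a, MoveRight), None)
  | CopyEdge, Some Semicolon =>
      (Count ForConclusion, (None, MoveLeft), Some Arrow)
  | CopyEdge, Some _ => (CopyEdge, (a, MoveRight), a)
  | SkipBack, Some Semicolon => (Count ForLink, (a, MoveLeft), None)
  | SkipBack, Some _ => (SkipBack, (a, MoveLeft), None)
  | Count u, Some _ => (Count u, (a, MoveLeft), Some (Bit true))
  | Count u, None => (Return u, (a, MoveRight), Some (terminator u))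
  | Return u, Some _ => (Return u, (a, MoveRight), None)
  | Return ForGround, None => (ScanEdges, (Some Semicolon, MoveRight), None)
  | Return ForTarget, None => (CopyEdge, (Some Semicolon, MoveRight), None)
  | Return ForConclusion, None =>
      (Count ForPremise, (None, MoveLeft), Some Semicolon)
  | Return ForPremise, None => (SkipBack, (None, MoveLeft), Some Arrow)
  | Return ForLink, None =>
      (CopyEdge, (Some Semicolon, MoveRight), Some Semicolon)
  | _, _ => (Halt, (a, Stay), None)
  end.

(** The output head moves only after writing a letter; otherwise it rewrites the blank under it, so
    the output tape keeps the shape given in [conf]. *)
Definition transducer : machine symbol :=
  @Machine symbol 1 control Init is_halt (fun q heads =>
    let: (q', a, o) := delta q (thead heads) in
    (q', [tuple a; (o, if o is Some _ then MoveRight else Stay)])).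

Definition conf (q : control) (T : tape symbol) (out : seq symbol) :
    config transducer :=
  (q, [tuple T; Tape (rev (map some out)) None [::]]).

Definition emit (o : cell symbol) : seq symbol := if o is Some s then [:: s] else [::].

(** * Runs and bounds on their length *)

Lemma step_conf q T out q' a o :
  ~~ is_halt q -> delta q (tape_head T) = (q', a, o) ->
  step (conf q T out) = conf q' (tape_act a T) (out ++ emit o).
Proof.
move=> /negPf q_run def_delta; rewrite /step /= q_run def_delta.
congr (_, _); apply: eq_from_tnth => i; rewrite tnth_mktuple.
case: i => [[|[|//]] lt_i]; rewrite /tnth //=.
by case: o {def_delta} => [s|] /=; rewrite ?cats0 // cats1 map_rcons rev_rcons.
Qed.

(** Only an upper bound on the number of steps is kept, so that costs add up along a run and are
    rounded up at its end. *)
Definition reaches t (c c' : config transducer) :=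
  exists2 n, n <= t & iter n (@step _ transducer) c = c'.

Lemma reaches_refl t c : reaches t c c.
Proof. by exists 0. Qed.

Lemma reaches_le t t' c c' : reaches t c c' -> t <= t' -> reaches t' c c'.
Proof. by case=> n le_n def_c' le_t; exists n => //; apply: leq_trans le_t. Qed.

Lemma reaches_trans t t' c c' c'' :
  reaches t c c' -> reaches t' c' c'' -> reaches (t + t') c c''.
Proof.
case=> n le_n <- [n' le_n' <-]; exists (n' + n); last by rewrite iterD.
by rewrite addnC leq_add.
Qed.

(** The [let] leaves the transition to be computed by reduction once the state and the scanned cell
    are known. *)
Lemma reaches_next t q T out c :
  ~~ is_halt q ->
  (let x := delta q (tape_head T) in
   reaches t (conf x.1.1 (tape_act x.1.2 T) (out ++ emit x.2)) c) ->
  reaches t.+1 (conf q T out) c.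
Proof.
case def_x: (delta _ _) => [[q' a] o] q_run [n le_n def_c]; exists n.+1 => //.
by rewrite iterSr (step_conf _ q_run def_x).
Qed.

(** The tape just after a move, with the head on the first cell of [l] or of [r]; the default [None]
    is the blank beyond the listed cells. *)
Definition at_left (l r : seq (cell symbol)) := Tape (behead l) (head None l) r.
Definition at_right (l r : seq (cell symbol)) := Tape l (head None r) (behead r).

(** * Sweeps of the head *)

Lemma sweep_right q (f : symbol -> cell symbol) (d : seq symbol) l r out :
  ~~ is_halt q ->
  (forall s, s \in d -> delta q (Some s) = (q, (Some s, MoveRight), f s)) ->
  reaches (size d) (conf q (at_right l (map some d ++ r)) out)
    (conf q (at_right (rev (map some d) ++ l) r) (out ++ pmap f d)).
Proof.
move=> q_run; elim: d l out => [|s d IHd] l out def_q.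
  by rewrite cats0; apply: reaches_refl.
apply: (reaches_next q_run); rewrite /= (def_q s (mem_head _ _)).
rewrite /= rev_cons cat_rcons.
have -> : out ++ oapp (cons^~ (pmap f d)) (pmap f d) (f s) =
    (out ++ emit (f s)) ++ pmap f d by rewrite -catA; case: (f s).
by apply: IHd => s' s'd; apply: def_q; rewrite inE s'd orbT.
Qed.

(** Letters are met from last to first, hence the induction at the end of [d] and the output taken
    from [rev d]. *)
Lemma sweep_left q (f : symbol -> cell symbol) (d : seq symbol) l r out :
  ~~ is_halt q ->
  (forall s, s \in d -> delta q (Some s) = (q, (Some s, MoveLeft), f s)) ->
  reaches (size d) (conf q (at_left (rev (map some d) ++ l) r) out)
    (conf q (at_left l (map some d ++ r)) (out ++ pmap f (rev d))).
Proof.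
move=> q_run; elim/last_ind: d r out => [|d s IHd] r out def_q.
  by rewrite cats0; apply: reaches_refl.
rewrite map_rcons !rev_rcons size_rcons /= cat_rcons.
have s_in : s \in rcons d s by rewrite mem_rcons mem_head.
apply: (reaches_next q_run); rewrite /= (def_q s s_in).
have -> : out ++ oapp (cons^~ (pmap f (rev d))) (pmap f (rev d)) (f s) =
    (out ++ emit (f s)) ++ pmap f (rev d) by rewrite -catA; case: (f s).
by apply: IHd => s' s'd; apply: def_q; rewrite mem_rcons inE s'd orbT.
Qed.

Lemma pmap_none (d : seq symbol) : pmap (fun=> None : cell symbol) d = [::].
Proof. by elim: d. Qed.

Lemma pmap_some (d : seq symbol) : pmap some d = d.
Proof. by elim: d => //= s d ->. Qed.

Lemma pmap_bit (d : seq symbol) :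
  pmap (fun=> Some (Bit true)) d = nseq (size d) (Bit true).
Proof. by elim: d => //= s d ->. Qed.

(* The blank keeps the sweeps to the left inside the stored cells. *)
Definition scanned (d : seq symbol) : seq (cell symbol) :=
  rev (map some d) ++ [:: None].

Lemma scanned_cat d e : scanned (d ++ e) = rev (map some e) ++ scanned d.
Proof. by rewrite /scanned map_cat rev_cat catA. Qed.

Lemma scanned_rcons d s : scanned (rcons d s) = Some s :: scanned d.
Proof. by rewrite -cats1 scanned_cat. Qed.

(** The sweep left emits one bit per letter of [d], the blank before the word triggers the
    terminator, and the sweep right crosses [d] and [e] to the blanked cell. The word [e] is
    nonempty only for [ForLink]. *)
Lemma count_unary u d e r out :
  reaches (2 * size d + size e + 1)
    (conf (Count u) (at_left (scanned d) (map some e ++ None :: r)) out)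
    (conf (Return u) (at_right (scanned (d ++ e)) (None :: r))
       (out ++ rcons (write_name (unary (size d))) (terminator u))).
Proof.
have sweepL := @sweep_left (Count u) (fun=> Some (Bit true)) d [:: None]
  (map some e ++ None :: r) out isT (fun _ _ => erefl).
rewrite pmap_bit size_rev -write_unary in sweepL.
have return_delta s : delta (Return u) (Some s) =
    (Return u, (Some s, MoveRight), None) by case: u {sweepL}.
have sweepR := @sweep_right (Return u) (fun=> None) (d ++ e) [:: None]
  (None :: r) ((out ++ write_name (unary (size d))) ++ [:: terminator u])
  isT (fun s _ => return_delta s).
rewrite -/(scanned (d ++ e)) pmap_none cats0 map_cat in sweepR.
rewrite -(catA (map some d)) in sweepR.
rewrite -cats1 catA; apply: reaches_le (reaches_trans sweepL _) _.
  by apply: reaches_next => //; apply: sweepR.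
by rewrite size_cat; lia.
Qed.

Lemma sweep_plain q (f : symbol -> cell symbol) (d e : seq symbol) r out :
  ~~ is_halt q ->
  (forall s, s <> Semicolon ->
     delta q (Some s) = (q, (Some s, MoveRight), f s)) ->
  Semicolon \notin e ->
  reaches (size e) (conf q (at_right (scanned d) (map some e ++ r)) out)
    (conf q (at_right (scanned (d ++ e)) r) (out ++ pmap f e)).
Proof.
move=> q_run def_q /negP no_semi; rewrite scanned_cat; apply: sweep_right => //.
by move=> s s_in; apply: def_q => def_s; case: no_semi; rewrite -def_s.
Qed.

(** The semicolons of the vertex set and of the edges are treated alike, whence the general [q]. The
    three extra steps blank the cell, turn at the left end and restore the semicolon. *)
Lemma emit_ground q d r out :
  ~~ is_halt q ->
  delta q (Some Semicolon) = (Count ForGround, (None, MoveLeft), None) ->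
  reaches (2 * size d + 3)
    (conf q (at_right (scanned d) (Some Semicolon :: r)) out)
    (conf ScanEdges (at_right (scanned (rcons d Semicolon)) r)
       (out ++ write_names [:: unary (size d)])).
Proof.
move=> q_run def_q; have := @count_unary ForGround d [::] r out.
rewrite cats0 scanned_rcons write_names1 => count.
apply: reaches_le (reaches_next q_run _) _.
  rewrite /= def_q /= cats0; apply: reaches_trans count _.
  apply: reaches_next => //=; rewrite cats0.
  exact: (reaches_refl 0).
by rewrite /=; lia.
Qed.

Lemma emit_target d r out :
  reaches (2 * size d + 3)
    (conf SkipVertices (at_right (scanned d) (Some Semicolon :: r)) out)
    (conf CopyEdge (at_right (scanned (rcons d Semicolon)) r)
       (out ++ rcons (write_name (unary (size d))) Semicolon)).
Proof.
have := @count_unary ForTarget d [::] r out.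
rewrite cats0 scanned_rcons => count.
apply: reaches_le (reaches_next (isT : ~~ is_halt SkipVertices) _) _.
  rewrite /= cats0; apply: reaches_trans count _.
  apply: reaches_next => //=; rewrite cats0.
  exact: (reaches_refl 0).
by rewrite /=; lia.
Qed.

(** * Passes over the edges and the complete run *)

Implicit Types (e : {fset name} * seq symbol)
  (es : seq ({fset name} * seq symbol)).

Definition edge_words es : seq symbol :=
  flatten [seq rcons e.2 Semicolon | e <- es].

Lemma edge_words_cons e es :
  edge_words (e :: es) = e.2 ++ Semicolon :: edge_words es.
Proof. by rewrite /edge_words /= cat_rcons. Qed.

Lemma size_edge_words es : size es <= size (edge_words es).
Proof.
elim: es => // e es IHes; rewrite edge_words_cons size_cat /=; lia.
Qed.

Definition semicolon_free es := forall e, e \in es -> Semicolon \notin e.2.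

(** Since [d] stops just before the last semicolon passed, [size d] is the position of that
    semicolon. Each block costs a sweep of at most [N] steps and a count of at most [2 * N + 3]. *)
Lemma scan_edges N d es out :
  semicolon_free es -> size d + (size (edge_words es)).+1 <= N ->
  reaches (size es * (3 * N + 3))
    (conf ScanEdges (at_right (scanned (rcons d Semicolon))
       (map some (edge_words es))) out)
    (conf ScanEdges (at_right (scanned (rcons d Semicolon ++ edge_words es)) [::])
       (out ++ write_names (map unary (positions (size d) es)))).
Proof.
elim: es d out => [|e es IHes] d out no_semi le_N.
  by rewrite !cats0; apply: reaches_refl.
rewrite edge_words_cons size_cat /= in le_N.
have sweep := @sweep_plain ScanEdges (fun=> None) (rcons d Semicolon) e.2
  (Some Semicolon :: map some (edge_words es)) out isT.
rewrite pmap_none cats0 in sweep.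
have count := @emit_ground ScanEdges (rcons d Semicolon ++ e.2)
  (map some (edge_words es)) out isT erefl.
have size_d : size (rcons d Semicolon ++ e.2) = size d + (size e.2).+1.
  by rewrite size_cat size_rcons addSnnS.
have := IHes (rcons d Semicolon ++ e.2)
  (out ++ write_names [:: unary (size d + (size e.2).+1)]).
rewrite size_d in count *; rewrite -catA -write_names_cat => rest.
rewrite edge_words_cons map_cat.
have -> : rcons d Semicolon ++ e.2 ++ Semicolon :: edge_words es =
   rcons (rcons d Semicolon ++ e.2) Semicolon ++ edge_words es.
  by rewrite [RHS]cat_rcons -catA.
apply: reaches_le (reaches_trans (sweep _ _) (reaches_trans count (rest _ _))) _.
- by case.
- by apply: no_semi; rewrite mem_head.
- by move=> f f_in; apply: no_semi; rewrite inE f_in orbT.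
- by lia.
- by rewrite /=; lia.
Qed.

Definition chain_words k es : seq symbol :=
  flatten [seq rcons (i.2.1 ++ Arrow :: i.2.2) Semicolon | i <- chain k es].

(** Two counts from the blanked semicolon write [unary k'] as conclusion of the edge and as premise
    of the link; a third, from the previous semicolon, writes [unary k]. *)
Lemma copy_edge d e r out :
  Semicolon \notin e.2 ->
  let k := size d in let k' := size d + (size e.2).+1 in
  reaches (8 * k' + 11)
    (conf CopyEdge (at_right (scanned (rcons d Semicolon))
       (map some e.2 ++ Some Semicolon :: r)) out)
    (conf CopyEdge
       (at_right (scanned (rcons (rcons d Semicolon ++ e.2) Semicolon)) r)
       (out ++ chain_words k [:: e])).
Proof.
move=> no_semi k k'; set d1 := rcons d Semicolon ++ e.2.
have size_d1 : size d1 = k' by rewrite size_cat size_rcons addSnnS.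
have sweep := @sweep_plain CopyEdge some (rcons d Semicolon) e.2
  (Some Semicolon :: r) out isT.
rewrite pmap_some in sweep.
set out1 := out ++ e.2 in sweep.
have := @count_unary ForConclusion d1 [::] r (out1 ++ [:: Arrow]).
have := @count_unary ForPremise d1 [::] r.
rewrite !cats0 size_d1 => count2 count1.
have back o := @sweep_left SkipBack (fun=> None) e.2
  (scanned (rcons d Semicolon)) (None :: r) o isT.
(* This count starts just left of the previous semicolon, so its return crosses that semicolon and
   the edge word before the blanked cell. *)
have count3 := @count_unary ForLink d (Semicolon :: e.2) r.
rewrite -(cat_rcons Semicolon d) -/d1 -/k in count3.
apply: reaches_le (reaches_trans (sweep _ no_semi) _) _; first by case.
  apply: (reaches_next (isT : ~~ is_halt CopyEdge)).
  apply: reaches_trans count1 _.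
  apply: (reaches_next (isT : ~~ is_halt (Return ForConclusion))).
  apply: reaches_trans (count2 _) _.
  apply: (reaches_next (isT : ~~ is_halt (Return ForPremise))).
  rewrite {2}/d1 scanned_cat.
  apply: reaches_trans (back _ _) _.
    move=> s s_in; case: s s_in => // s_in.
    by rewrite s_in in no_semi.
  rewrite scanned_rcons pmap_none cats0.
  apply: (reaches_next (isT : ~~ is_halt SkipBack)).
  rewrite /= cats0.
  apply: reaches_trans (count3 _) _.
  apply: (reaches_next (isT : ~~ is_halt (Return ForLink))).
  rewrite scanned_rcons /=.
  have -> : out ++ chain_words k [:: e] = ((((((out1 ++ [:: Arrow]) ++
      rcons (write_name (unary k')) Comma) ++ [:: Semicolon]) ++
      rcons (write_name (unary k')) Comma) ++ [:: Arrow]) ++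
      rcons (write_name (unary k)) Comma) ++ [:: Semicolon].
    rewrite /chain_words /= -/k' !write_names1 cats0 /out1.
    by rewrite -!cats1 /= -!catA /= -!catA.
  exact: (reaches_refl 0).
by rewrite /=; lia.
Qed.

Lemma copy_edges N d es r out :
  semicolon_free es -> size d + (size (edge_words es)).+1 <= N ->
  reaches (size es * (8 * N + 11))
    (conf CopyEdge (at_right (scanned (rcons d Semicolon))
       (map some (edge_words es) ++ r)) out)
    (conf CopyEdge (at_right (scanned (rcons d Semicolon ++ edge_words es)) r)
       (out ++ chain_words (size d) es)).
Proof.
elim: es d out => [|e es IHes] d out no_semi le_N.
  by rewrite !cats0; apply: reaches_refl.
rewrite edge_words_cons size_cat /= in le_N.
have := @copy_edge d e (map some (edge_words es) ++ r) out
  (no_semi _ (mem_head _ _)).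
have := IHes (rcons d Semicolon ++ e.2) (out ++ chain_words (size d) [:: e]).
rewrite size_cat size_rcons addSnnS -catA => rest copy.
rewrite edge_words_cons map_cat -catA.
have -> : rcons d Semicolon ++ e.2 ++ Semicolon :: edge_words es =
   rcons (rcons d Semicolon ++ e.2) Semicolon ++ edge_words es.
  by rewrite [RHS]cat_rcons -catA.
have -> : chain_words (size d) (e :: es) = chain_words (size d) [:: e] ++
    chain_words (size d + (size e.2).+1) es.
  by rewrite /chain_words /= cats0 !catA.
apply: reaches_le (reaches_trans copy (rest _ _)) _.
- by move=> f f_in; apply: no_semi; rewrite inE f_in orbT.
- by lia.
- by rewrite /=; lia.
Qed.

Lemma transducer_run v es :
  Semicolon \notin v -> semicolon_free es ->
  let w := v ++ Semicolon :: edge_words es in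
  exists T, reaches (15 * (size w).+1 ^ 2) (init_config transducer w)
    (conf Halt T (chain_output v es)).
Proof.
move=> v_free es_free w.
have size_w : size w = size v + (size (edge_words es)).+1.
  by rewrite size_cat.
(* Each edge owns a semicolon, so there are fewer edges than input letters; this keeps the total
   cost quadratic. *)
have le_es := size_edge_words es.
have def_w : w = rcons v Semicolon ++ edge_words es by rewrite cat_rcons.
have -> : init_config transducer w = conf Init (at_right [::] (map some w)) [::].
  by rewrite /init_config /conf; congr (_, _); apply: val_inj; case: (w).
have copyV := @sweep_plain CopyVertices some [::] v
  (Some Semicolon :: map some (edge_words es)) [::] isT.
rewrite pmap_some !cat0s in copyV.
have ground := @emit_ground CopyVertices v (map some (edge_words es)) v isT erefl.
have scan := @scan_edges (size w) v es (v ++ write_names [:: unary (size v)])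
  es_free.
rewrite -def_w -(catA v) -write_names_cat in scan.
set out1 := v ++ write_names (_ ++ _) in scan.
(* The second [[:: None]] is the blank after the word, which became a listed cell when the head
   turned back on it. *)
have rewind := @sweep_left Rewind (fun=> None) w [:: None] [:: None]
  (out1 ++ [:: Semicolon]) isT (fun _ _ => erefl).
rewrite pmap_none cats0 in rewind.
have skipV := @sweep_plain SkipVertices (fun=> None) [::] v
  (Some Semicolon :: map some (edge_words es) ++ [:: None])
  (out1 ++ [:: Semicolon]) isT.
rewrite pmap_none cats0 in skipV.
have target := @emit_target v (map some (edge_words es) ++ [:: None])
  (out1 ++ [:: Semicolon]).
set out2 := _ ++ rcons _ _ in target.
have copyE := @copy_edges (size w) v es [:: None] out2 es_free.
eexists; apply: reaches_le _ _.
  (* One step left and one back make the blank before the word a listed cell, as [scanned]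
     requires. *)
  apply: (reaches_next (isT : ~~ is_halt Init)).
  apply: (reaches_next (isT : ~~ is_halt Entry)).
  rewrite [map some w]map_cat.
  apply: reaches_trans (copyV _ v_free) _; first by case.
  apply: reaches_trans ground _.
  apply: reaches_trans (scan _) _; first by rewrite size_w.
  apply: (reaches_next (isT : ~~ is_halt ScanEdges)).
  apply: reaches_trans rewind _.
  apply: (reaches_next (isT : ~~ is_halt Rewind)).
  rewrite /= cats0 /w map_cat -catA.
  apply: reaches_trans (skipV _ v_free) _; first by case.
  apply: reaches_trans target _.
  apply: reaches_trans (copyE _) _; first by rewrite size_w.
  (* Reading the blank after the last edge falls under the default case of [delta], which halts. *)
  apply: (reaches_next (isT : ~~ is_halt CopyEdge)).
  rewrite /= cats0.
  have -> : chain_output v es = out2 ++ chain_words (size v) es.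
    by rewrite /chain_output /out2 /out1 -cats1 -!catA.
  exact: (reaches_refl 0).
(* With [N] the input length, the two passes cost [11 * N + 14] per edge and the remaining steps are
   linear in [N]. *)
by rewrite size_w /=; nia.
Qed.

End Transducer.

Theorem theorem18 :
  exists (M : machine symbol) (p : {poly nat}),
  forall (H : hypergraph) (w : seq symbol),
    sperner H -> encodes_hypergraph H w ->
    exists (I : acs_instance) (w' : seq symbol),
      [/\ outputs_within M (p.[size w])%R w w',
          encodes_acs I w',
          acyclic (base I),
          conclusion_degree (base I) <= 2
        & forall S : {fset name}, irr (base I) (target I) S <-> MIS H S].
Proof.
exists transducer, (15%N%:P * ('X + 1%N%:P) ^+ 2)%R => H w _ [v [es]].
case=> enc_v enc_E enc_es def_w.
(* The instance depends on the encoding as well as on [H], through the order of the edges and the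
   positions of the semicolons. *)
exists (chain_instance enc_v enc_E), (chain_output v es); split.
- have v_free : Semicolon \notin v.
    by case: enc_v => s _ ->; apply: semicolon_write_names.
  have es_free : semicolon_free es.
    by move=> e /enc_es[s _ ->]; apply: semicolon_write_names.
  have [T [n le_n def_c]] := transducer_run v_free es_free.
  rewrite -[_ ++ _]/(v ++ _) -def_w in le_n def_c.
  have -> : (15%N%:P * ('X + 1%N%:P) ^+ 2).[size w]%R = (15 * (size w).+1 ^ 2)%N.
    rewrite hornerCM horner_exp hornerD hornerX hornerC.
    by rewrite -[LHS]/(15 * (size w + 1) ^ 2)%N addn1.
  rewrite /outputs_within -(subnK le_n) iterD def_c.
  (* A halted configuration is fixed by [step], so the remaining time changes nothing. *)
  have -> : iter (15 * (size w).+1 ^ 2 - n) (@step _ transducer)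
      (conf Halt T (chain_output v es)) = conf Halt T (chain_output v es).
    by elim: (_ - n)%N => //= m ->.
  (* No blank precedes the output; the single one after it is the cell under the head. *)
  split=> //; exists 0, 1.
  by rewrite (tnth_nth (Tape [::] None [::])) /= revK.
- exact: encodes_chain.
- exact: acyclic_chain.
- exact: conclusion_degree_chain.
- exact: irr_chain.
Qed.
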